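(* Let $G$ be a commutative Krasner $(m,n)$-hyperring with scalar identity $1$, let $t$ be a positive integer, and let $\delta$ be an intersection preserving hyperideal expansion of $G$. If $Q_1,\dots,Q_s$ are $(t,n)$-absorbing $\delta$-semiprimary hyperideals of $G$ such that $\delta(Q_i)=P$ for each $1\le i\le s$, then $Q=\bigcap_{i=1}^s Q_i$ is a $(t,n)$-absorbing $\delta$-semiprimary hyperideal of $G$ with $\delta(Q)=P$.
   Context: Notation: $a_i^j$ is the sequence $a_i,a_{i+1},\dots,a_j$ (empty if $j<i$), $a^{(r)}$ is $a$ repeated $r$ times; $m,n\ge 2$ are integers. A Krasner $(m,n)$-hyperring $(G,h,k)$ consists of a set $G$, an $m$-ary hyperoperation $h$ (with values nonempty subsets of $G$, extended to subsets by unions) and an $n$-ary operation $k:G^n\to G$ such that: (1) $(G,h)$ is a canonical $m$-ary hypergroup, i.e. $h$ is associative and invariant under permutation of its arguments, there is a unique element $0$ with $h(x,0^{(m-1)})=\{x\}$ for all $x$, each $x$ has a unique $-x$ with $0\in h(x,-x,0^{(m-2)})$, and $x\in h(x_1^m)$ implies $x_i\in h(x,-x_1,\dots,-x_{i-1},-x_{i+1},\dots,-x_m)$ for each $i$; (2) $k$ is associative ($(G,k)$ is an $n$-ary semigroup); (3) $k(g_1^{i-1},h(x_1^m),g_{i+1}^n)=h(k(g_1^{i-1},x_1,g_{i+1}^n),\dots,k(g_1^{i-1},x_m,g_{i+1}^n))$ for each $i$; (4) $k$ equals $0$ whenever one of its arguments is $0$. It is commutative if $k$ is invariant under permutation of its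 arguments; $1$ is a scalar identity if $k(x,1^{(n-1)})=x$ for all $x$. By iterating, $k$ is defined on any $l(n-1)+1$ elements, $l\ge 0$ (for $l=0$ the product of one element is that element); note $tn-t+1=t(n-1)+1$ and $(t-1)n-t+2=(t-1)(n-1)+1$. A hyperideal is a nonempty $I\subseteq G$ such that $(I,h)$ is an $m$-ary subhypergroup of $(G,h)$ (so $I$ is closed under $h$ and negatives) and $k(g_1^{i-1},I,g_{i+1}^n)\subseteq I$ for all $g_j\in G$ and all $i$. A hyperideal expansion of $G$ is a function $\delta$ from hyperideals to hyperideals of $G$ with $I\subseteq\delta(I)$, and $I\subseteq J$ implying $\delta(I)\subseteq\delta(J)$. It is intersection preserving if $\delta(I\cap J)=\delta(I)\cap\delta(J)$ for all hyperideals $I,J$ of $G$. A proper hyperideal $Q$ of $G$ is $(t,n)$-absorbing $\delta$-semiprimary if whenever $k(a_1^{tn-t+1})\in Q$ for $a_1,\dots,a_{tn-t+1}\in G$, there exist $(t-1)n-t+2$ of the $a_i$'s (distinct indices) whose $k$-product is in $\delta(Q)$. *)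

(* Defs.v *)
From mathcomp Require Import all_boot all_fingroup.
From mathcomp Require Import boolp classical_sets.

Set Implicit Arguments.
Unset Strict Implicit.
Unset Printing Implicit Defensive.

Local Open Scope classical_set_scope.

(* The n-tuple with entries s; every use below has size s = n, so that the
   default x0 plays no role. *)
Definition seqt (T : Type) (n : nat) (x0 : T) (s : seq T) : n.-tuple T :=
  [tuple nth x0 s i | i < n].

(* (g_1^{i-1}, y, g_{i+1}^n) : the i-th entry of g is discarded. *)
Definition subst_at (T : Type) (n : nat) (g : n.-tuple T) (i : 'I_n) (y : T) :
    n.-tuple T :=
  [tuple if j == i then y else tnth g j | j < n].

Definition perm_tuple (T : Type) (n : nat) (p : 'S_n) (x : n.-tuple T) :
    n.-tuple T :=
  [tuple tnth x (p i) | i < n].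

Section Operations.
Variables (G : Type) (m n : nat).
Implicit Types (h : m.-tuple G -> set G) (k : n.-tuple G -> G).

(* Extension of a hyperoperation to subsets, by unions. *)
Definition hext h (A : m.-tuple (set G)) : set G :=
  [set y | exists2 x : m.-tuple G,
             (forall i, tnth A i (tnth x i)) & h x y].

(* h(x_0^{i-1}, h(x_i^{i+m-1}), x_{i+m}^{2m-2}) with i < m; only the first
   2m-1 terms of the family x are used. *)
Definition hnest h (x : nat -> G) (i : nat) : set G :=
  hext h [tuple if (p < i)%N then [set x p]
                else if p == i :> nat then h [tuple x (i + q) | q < m]
                else [set x (p + m.-1)] | p < m].

Definition hassociative h :=
  forall (x : nat -> G) (i j : 'I_m), hnest h x i = hnest h x j.

Definition knest k (x : nat -> G) (i : nat) : G :=
  k [tuple if (p < i)%N then x p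
           else if p == i :> nat then k [tuple x (i + q) | q < n]
           else x (p + n.-1) | p < n].

Definition kassociative k :=
  forall (x : nat -> G) (i j : 'I_n), knest k x i = knest k x j.

End Operations.

Record canonical_hypergroup (G : Type) (m : nat) (h : m.-tuple G -> set G)
    (zero : G) (opp : G -> G) : Prop := CanonicalHypergroup {
  h_nonempty : forall x, h x !=set0;
  h_assoc : hassociative h;
  h_perm : forall (p : 'S_m) x, h (perm_tuple p x) = h x;
  h_zero : forall x, h (seqt m zero (x :: nseq m.-1 zero)) = [set x];
  h_zero_unique : forall e,
    (forall x, h (seqt m e (x :: nseq m.-1 e)) = [set x]) -> e = zero;
  h_opp : forall x, h (seqt m zero [:: x, opp x & nseq m.-2 zero]) zero;
  h_opp_unique : forall x y,
    h (seqt m zero [:: x, y & nseq m.-2 zero]) zero -> y = opp x;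
  h_reversible : forall (x : G) (xs : m.-tuple G) (i : 'I_m), h xs x ->
    h (seqt m zero (x :: map opp (take i xs ++ drop i.+1 xs))) (tnth xs i)
}.

Record krasner_hyperring (m n : nat) := KrasnerHyperring {
  carrier :> Type;
  kh_h : m.-tuple carrier -> set carrier;
  kh_k : n.-tuple carrier -> carrier;
  kh_zero : carrier;
  kh_opp : carrier -> carrier;
  kh_canonical : canonical_hypergroup kh_h kh_zero kh_opp;
  kh_kassoc : kassociative kh_k;
  kh_distr : forall (g : n.-tuple carrier) (i : 'I_n) (x : m.-tuple carrier),
    [set kh_k (subst_at g i y) | y in kh_h x]
    = kh_h [tuple kh_k (subst_at g i (tnth x j)) | j < m];
  kh_absorb : forall (g : n.-tuple carrier) (i : 'I_n),
    tnth g i = kh_zero -> kh_k g = kh_zero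
}.

Section Theory.
Variables (m n : nat) (G : krasner_hyperring m n).
Implicit Types (I J Q : set G) (delta : set G -> set G).

Local Notation h := (@kh_h m n G).
Local Notation k := (@kh_k m n G).

Definition commutative_hyperring :=
  forall (p : 'S_n) (x : n.-tuple G), k (perm_tuple p x) = k x.

Definition scalar_identity (one : G) :=
  forall x : G, k (seqt n one (x :: nseq n.-1 one)) = x.

(* k(...k(k(x, s_1^{n-1}), s_n^{2n-2})...), with l applications of k. *)
Fixpoint kiter (l : nat) (x : G) (s : seq G) : G :=
  if l is l'.+1 then
    kiter l' (k (seqt n x (x :: take n.-1 s))) (drop n.-1 s)
  else x.

Definition kprod (l : nat) (a : (l * n.-1).+1.-tuple G) : G :=
  kiter l (thead a) (behead a).

(* I is an m-ary subhypergroup of (G, h), i.e. closed under h and negatives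
   (it contains zero by hi_k, so reversibility makes the equations
   b \in h(a_1^{i-1}, x, a_{i+1}^m) solvable in I), and absorbs products. *)
Record hyperideal I : Prop := Hyperideal {
  hi_nonempty : I !=set0;
  hi_h : forall x : m.-tuple G, (forall i, I (tnth x i)) -> h x `<=` I;
  hi_opp : forall x, I x -> I (kh_opp x);
  hi_k : forall (g : n.-tuple G) (i : 'I_n) (y : G),
    I y -> I (k (subst_at g i y))
}.

(* delta is only constrained on hyperideals: its values elsewhere are never
   used. *)
Record hyperideal_expansion delta : Prop := HyperidealExpansion {
  he_hyperideal : forall I, hyperideal I -> hyperideal (delta I);
  he_sub : forall I, hyperideal I -> I `<=` delta I;
  he_mono : forall I J, hyperideal I -> hyperideal J ->
    I `<=` J -> delta I `<=` delta J
}.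

Definition intersection_preserving delta :=
  forall I J, hyperideal I -> hyperideal J ->
    delta (I `&` J) = delta I `&` delta J.

(* The injection f selects (t-1)(n-1)+1 of the t(n-1)+1 indices. *)
Record absorbing_semiprimary (t : nat) delta Q : Prop :=
  AbsorbingSemiprimary {
  as_hyperideal : hyperideal Q;
  as_proper : Q <> [set: G];
  as_absorbing : forall a : (t * n.-1).+1.-tuple G, Q (kprod a) ->
    exists f : 'I_(t.-1 * n.-1).+1 -> 'I_(t * n.-1).+1,
      injective f /\ delta Q (kprod [tuple tnth a (f i) | i < (t.-1 * n.-1).+1])
}.

End Theory.

(* Main.v *)
Require Import Defs.
From mathcomp Require Import all_boot all_fingroup.
From mathcomp Require Import boolp classical_sets.

(** Every hyperideal contains 0 (as 2 <= n), so the intersection of two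
    hyperideals is nonempty and is again a hyperideal.  By
    induction, an intersection preserving delta that takes the value P at each
    member of a finite nonempty family of hyperideals takes the value P at their
    intersection [hyperideal_expansion_bigcap]; so delta (\bigcap_i Q i) = P.  Absorption is then inherited from any single
    member: a product in the intersection lies in some Q i, which yields a
    subproduct in delta (Q i) = P = delta (\bigcap_i Q i). *)

Local Open Scope classical_set_scope.

Lemma hyperideal_zero {m n : nat} (hn : (2 <= n)%N) (G : krasner_hyperring m n)
    (I : set G) : hyperideal I -> I (kh_zero G).
Proof.
move=> hI; have [y Iy] := hi_nonempty hI.
have hn0 : (0 < n)%N by apply: leq_trans hn.
(* The product k(y, 0, ..., 0) lies in I, and vanishes because of its second
   argument. *)
pose g := [tuple kh_zero G | _ < n].
have := hi_k hI g (Ordinal hn0) Iy.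
rewrite (_ : kh_k _ = kh_zero G) //.
by apply: (@kh_absorb _ _ _ _ (Ordinal hn)); rewrite !tnth_mktuple.
Qed.

Lemma hyperideal_setI {m n : nat} (hn : (2 <= n)%N) (G : krasner_hyperring m n)
    (I J : set G) : hyperideal I -> hyperideal J -> hyperideal (I `&` J).
Proof.
move=> hI hJ; split.
- by exists (kh_zero G); split; apply: hyperideal_zero.
- move=> x IJx y hxy; split.
  + by apply: (hi_h hI) hxy => i; have [] := IJx i.
  + by apply: (hi_h hJ) hxy => i; have [] := IJx i.
- by move=> x [Ix Jx]; split; [apply: hi_opp Ix | apply: hi_opp Jx].
- by move=> g i y [Iy Jy]; split; apply: hi_k.
Qed.

(** The family is indexed by a nonempty finite list: the intersection of the
    empty family is G, on which delta need not take the value P. *)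
Lemma hyperideal_expansion_bigcap {m n : nat} (hn : (2 <= n)%N)
    (G : krasner_hyperring m n) (delta : set G -> set G)
    (hcap : intersection_preserving delta)
    (T : eqType) (Q : T -> set G) (P : set G)
    (hQ : forall i, hyperideal (Q i)) (hP : forall i, delta (Q i) = P)
    (i0 : T) (l : seq T) :
  hyperideal (\bigcap_(i in [set` i0 :: l]) Q i)
  /\ delta (\bigcap_(i in [set` i0 :: l]) Q i) = P.
Proof.
elim: l i0 => [|j l IHl] i; first by rewrite set_cons1 bigcap_set1.
have [hIl dIl] := IHl j.
rewrite (_ : [set` _] = i |` [set` j :: l]); last first.
  by apply/seteqP; split=> x; rewrite /= inE => /predU1P.
rewrite bigcap_setU1; split; first exact: hyperideal_setI.
by rewrite hcap // dIl hP setIid.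
Qed.

Theorem theorem2p7 (m n : nat) (hm : (2 <= m)%N) (hn : (2 <= n)%N)
    (G : krasner_hyperring m n) (hcomm : commutative_hyperring G)
    (one : G) (hone : scalar_identity one)
    (t : nat) (ht : (0 < t)%N)
    (delta : set G -> set G) (hdelta : hyperideal_expansion delta)
    (hcap : intersection_preserving delta)
    (s : nat) (hs : (0 < s)%N) (Q : 'I_s -> set G) (P : set G)
    (hQ : forall i, absorbing_semiprimary t delta (Q i))
    (hP : forall i, delta (Q i) = P) :
  absorbing_semiprimary t delta (\bigcap_i Q i)
  /\ delta (\bigcap_i Q i) = P.
Proof.
pose i0 : 'I_s := Ordinal hs.
have allE : [set` i0 :: enum 'I_s] = [set: 'I_s].
  by apply/seteqP; split => // i _; rewrite /= inE mem_enum orbT.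
have [hI dI] := hyperideal_expansion_bigcap hn G delta hcap _ Q P
  (fun i => as_hyperideal (hQ i)) hP i0 (enum 'I_s).
rewrite allE in hI dI; split=> //; split=> //.
- move=> IT; apply: (as_proper (hQ i0)); apply/seteqP; split=> // x _.
  by have : [set: G] x by []; rewrite -IT => /(_ i0 I).
- move=> a Qa; have [f [finj Pf]] := as_absorbing (hQ i0) (Qa i0 I).
  by exists f; split=> //; rewrite dI -(hP i0).
Qed.
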